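(* Let $(Q,\leq,\cdot,\rightarrow,0,1)$ be a bounded commutative residuated monoid, let $a\in Q$ with $a\cdot a=a$, put $\mathbf Q:=(Q,\leq)$, and let $$P_a(\mathbf Q):=\{(x,y)\in Q^2\mid L(x,y)\leq a\leq U(x,y)\},$$ ordered by $(x,y)\leq(z,v)$ if and only if $x\leq z$ and $v\leq y$. Assume that every element of $P_a(\mathbf Q)$ is comparable with $(a,a)$. Then the following hold: (A) Let the operators $\odot$ and $\Rightarrow$ be defined by \begin{align*} (x,y)\odot(z,v) & :=\{(x\cdot z,\,x\rightarrow v),\,(x\cdot z,\,z\rightarrow y)\}, \\ (x,y)\Rightarrow(z,v) & :=\{(x\rightarrow z,\,x\cdot v),\,(v\rightarrow y,\,x\cdot v)\} \end{align*} for all $(x,y),(z,v)\in P_a(\mathbf Q)$. Then $(P_a(\mathbf Q),\leq,\odot,\Rightarrow,(0,1),(1,0))$ is an operator residuated poset if and only if the following two conditions hold for all $x\in Q$: (1) $a\cdot x<a$ implies $a\cdot x=0$; (2) $a<x$ implies $x\rightarrow a=a$. (B) $(P_a(\mathbf Q),\leq,{}')$, where $(x,y)':=(y,x)$ for all $(x,y)\in P_a(\mathbf Q)$, is a pseudo-Kleene poset. (C) The mapping $x\mapsto(x,a)$ is an embedding of $\mathbf Q$ into $(P_a(\mathbf Q),\leq)$. (D) $(x,y)'\in(x,y)\Rightarrow(0,1)$ for all $(x,y)\in P_a(\mathbf Q)$.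
   Context: A bounded commutative residuated monoid $(Q,\leq,\cdot,\rightarrow,0,1)$ is a poset $(Q,\leq)$ with least element $0$ and greatest element $1$ and with binary operations $\cdot,\rightarrow$ such that $\cdot$ is commutative and associative, $x\cdot 1=x$ for all $x\in Q$, and for all $x,y,z\in Q$: $x\cdot y\leq z$ if and only if $x\leq y\rightarrow z$. For a poset $(P,\leq)$ and $x,y\in P$, $L(x,y)$ is the set of all lower bounds of $\{x,y\}$ in $P$ and $U(x,y)$ is the set of all upper bounds of $\{x,y\}$ in $P$. In the definition of $P_a(\mathbf Q)$ these cones are taken in $\mathbf Q$. For subsets $A,B$ of a poset, $A\leq B$ means $x\leq y$ for all $x\in A$ and $y\in B$; singletons are identified with their elements, so $A\leq z$ means $x\leq z$ for all $x\in A$, and $x\leq B$ means $x\leq y$ for all $y\in B$. An operator residuated poset is an ordered six-tuple $(P,\leq,\odot,\Rightarrow,0,1)$ such that: (i) $(P,\leq,0,1)$ is a bounded poset ($0$ least, $1$ greatest); (ii) $\odot$ and $\Rightarrow$ are mappings from $P^2$ to $2^P$ (so in particular all values must be subsets of $P$); and for all $x,y,z\in P$: (iii) $x\odot y=y\odot x$; (iv) $\bigcup_{u\in x\odot y}(u\odot z)=\bigcup_{u\in y\odot z}(x\odot u)$; (v) $x\odot y\leq z$ if and only if $x\leq y\Rightarrow z$. A pseudo-Kleene poset is a poset $(P,\leq,{}')$ with a unary operation ${}'$ that is antitone ($x\leq y$ implies $y'\leq x'$) and an involution ($x''=x$), satisfying $L(x,x')\leq U(y,y')$ for all $x,y\in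 P$ (cones taken in $P$). An embedding of posets is a map $h$ such that $x\leq y$ if and only if $h(x)\leq h(y)$. *)

(* Defs.v *)
From mathcomp Require Import all_boot all_order.
From mathcomp Require Import boolp classical_sets.

Set Implicit Arguments.
Unset Strict Implicit.
Unset Printing Implicit Defensive.

Import Order.Theory.
Local Open Scope order_scope.

Record bounded_commutative_residuated_monoid (d : Order.disp_t)
    (Q : tbPOrderType d) (mul imp : Q -> Q -> Q) : Prop := {
  bcrm_mulC : commutative mul;
  bcrm_mulA : associative mul;
  bcrm_mul1 : right_id \top mul;
  bcrm_residuation : forall x y z : Q, mul x y <= z <-> x <= imp y z
}.

Definition set_le (d : Order.disp_t) (T : porderType d) (A B : set T) : Prop :=
  forall x y : T, A x -> B y -> x <= y.

(* A poset is represented below by a subset P of a partially ordered type T,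
   with the order inherited from T.  An operation on P is a function on all of
   T; only its values on P matter, and it is required to take them in P. *)

Definition lower_cone (d : Order.disp_t) (T : porderType d) (P : set T)
    (x y : T) : set T :=
  setI P (lbound [set x; y]%classic).

Definition upper_cone (d : Order.disp_t) (T : porderType d) (P : set T)
    (x y : T) : set T :=
  setI P (ubound [set x; y]%classic).

Record operator_residuated_poset (d : Order.disp_t) (T : porderType d)
    (P : set T) (odot imp : T -> T -> set T) (o i : T) : Prop := {
  orp_bot_in : P o;
  orp_top_in : P i;
  orp_bot_le : forall x : T, P x -> o <= x;
  orp_le_top : forall x : T, P x -> x <= i;
  orp_odot_closed : forall x y : T, P x -> P y -> (odot x y `<=` P)%classic;
  orp_imp_closed : forall x y : T, P x -> P y -> (imp x y `<=` P)%classic;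
  orp_odotC : forall x y : T, P x -> P y -> odot x y = odot y x;
  orp_odotA : forall x y z : T, P x -> P y -> P z ->
    (\bigcup_(u in odot x y) odot u z = \bigcup_(u in odot y z) odot x u)%classic;
  orp_residuation : forall x y z : T, P x -> P y -> P z ->
    set_le (odot x y) [set z]%classic <-> set_le [set x]%classic (imp y z)
}.

Record pseudo_kleene_poset (d : Order.disp_t) (T : porderType d)
    (P : set T) (compl : T -> T) : Prop := {
  pkp_closed : forall x : T, P x -> P (compl x);
  pkp_antitone : forall x y : T, P x -> P y -> x <= y -> compl y <= compl x;
  pkp_involutive : forall x : T, P x -> compl (compl x) = x;
  pkp_kleene : forall x y : T, P x -> P y ->
    set_le (lower_cone P x (compl x)) (upper_cone P y (compl y))
}.

(* Pairs ordered by the product of the order of Q and its dual. *)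
Notation twist Q := (Q *p Q^d)%type.

Definition mk_twist (d : Order.disp_t) (Q : porderType d) (x y : Q) : twist Q :=
  (x, y).

Lemma twist_leE (d : Order.disp_t) (Q : porderType d) (x y z v : Q) :
  (mk_twist x y <= mk_twist z v) = (x <= z) && (v <= y).
Proof. by []. Qed.

Definition Pa (d : Order.disp_t) (Q : porderType d) (a : Q) : set (twist Q) :=
  fun p => let: (x, y) := p : Q * Q in
    set_le (lower_cone setT x y) [set a]%classic /\
    set_le [set a]%classic (upper_cone setT x y).

Definition twist_compl (d : Order.disp_t) (Q : porderType d) (p : twist Q) :
    twist Q :=
  let: (x, y) := p : Q * Q in mk_twist y x.

Definition twist_odot (d : Order.disp_t) (Q : porderType d)
    (mul imp : Q -> Q -> Q) (p q : twist Q) : set (twist Q) :=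
  let: (x, y) := p : Q * Q in
  let: (z, v) := q : Q * Q in
  [set mk_twist (mul x z) (imp x v); mk_twist (mul x z) (imp z y)]%classic.

Definition twist_imp (d : Order.disp_t) (Q : porderType d)
    (mul imp : Q -> Q -> Q) (p q : twist Q) : set (twist Q) :=
  let: (x, y) := p : Q * Q in
  let: (z, v) := q : Q * Q in
  [set mk_twist (imp x z) (mul x v); mk_twist (imp v y) (mul x v)]%classic.

(* Main.v *)
(** Every pair (x, a) lies in P_a(Q), so comparability with (a, a) says that
    every x is comparable with a, and hence that (x, y) is in P_a(Q) iff
    x <= a <= y or y <= a <= x.  All axioms of an operator residuated poset
    except closure then hold unconditionally, by residuation and
    x -> (y -> z) = (x y) -> z, and closure of => reduces to closure of (.)
    because p => q consists of the swaps of the elements of p (.) q'.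
    Closure of (.) is what conditions (1) and (2) express: they are necessary
    by looking at (1, 0) (.) (a x, 1) for a x < a and at (x, 0) (.) (1, a) for
    a < x. *)

Require Import Defs.
From mathcomp Require Import all_boot all_order.
From mathcomp Require Import boolp classical_sets.
Import Order.Theory.
Local Open Scope order_scope.

(** * Residuated monoid calculus and the operator identities on pairs *)

Section ResiduatedMonoid.
Set Implicit Arguments.
Unset Strict Implicit.

Variables (d : Order.disp_t) (Q : tbPOrderType d) (mul imp : Q -> Q -> Q).
Hypothesis HQ : bounded_commutative_residuated_monoid mul imp.

Let mulC : commutative mul := bcrm_mulC HQ.
Let mulA : associative mul := bcrm_mulA HQ.

Lemma le_residual (x y z : Q) : (x <= imp y z) = (mul x y <= z).
Proof. by apply/idP/idP => /(bcrm_residuation HQ). Qed.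

Lemma mul_impl_le (x y : Q) : mul (imp x y) x <= y.
Proof. by rewrite -le_residual. Qed.

(** An element is determined by its lower set; with residuation this turns identities between
    residuals into identities between products. *)
Lemma eq_from_le (x y : Q) : (forall u, (u <= x) = (u <= y)) -> x = y.
Proof. by move=> e; apply: le_anti; rewrite -e lexx e lexx. Qed.

Lemma imp_curry (x y z : Q) : imp x (imp y z) = imp (mul x y) z.
Proof. by apply: eq_from_le => u; rewrite !le_residual mulA. Qed.

Lemma imp_top (x : Q) : imp \top x = x.
Proof. by apply: eq_from_le => u; rewrite le_residual (bcrm_mul1 HQ). Qed.

Lemma mul_top (x : Q) : mul \top x = x.
Proof. by rewrite mulC (bcrm_mul1 HQ). Qed.

Lemma le_mul2r (z x y : Q) : x <= y -> mul x z <= mul y z.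
Proof. by rewrite -le_residual => /le_trans; apply; rewrite le_residual. Qed.

Lemma le_mul2l (z x y : Q) : x <= y -> mul z x <= mul z y.
Proof. by rewrite !(mulC z); apply: le_mul2r. Qed.

Lemma le_mul (x y z v : Q) : x <= z -> y <= v -> mul x y <= mul z v.
Proof. by move=> /(le_mul2r y) h /(le_mul2l z); apply: le_trans. Qed.

Lemma mul_le_l (x y : Q) : mul x y <= x.
Proof. by rewrite -[leRHS](bcrm_mul1 HQ) le_mul2l ?lex1. Qed.

Lemma le_imp2l (x y z : Q) : y <= z -> imp x y <= imp x z.
Proof. by rewrite le_residual; apply: le_trans; apply: mul_impl_le. Qed.

Lemma twist_odotC (p q : twist Q) :
  twist_odot mul imp p q = twist_odot mul imp q p.
Proof. by case: p q => [x y] [z v] /=; rewrite (mulC z) setUC. Qed.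

(** After currying, both unions consist of the same three pairs: first component [x z w], second
    component [x z -> t], [x w -> v] or [z w -> y]. *)
Lemma twist_odotA (p q r : twist Q) :
  (\bigcup_(u in twist_odot mul imp p q) twist_odot mul imp u r =
   \bigcup_(u in twist_odot mul imp q r) twist_odot mul imp p u)%classic.
Proof.
case: p q r => [x y] [z v] [w t] /=.
rewrite !bigcup_setU !bigcup_set1 /= !imp_curry -mulA (mulC w x) (mulC w z).
rewrite -!setUA; apply/seteqP; split=> u /=; tauto.
Qed.

(** By residuation, each side says exactly [x z <= s], [x t <= v] and [z t <= y]. *)
Lemma twist_residuation (p q r : twist Q) :
  set_le (twist_odot mul imp p q) [set r]%classic <->
  set_le [set p]%classic (twist_imp mul imp q r).
Proof.
have set_le2 (s t : twist Q) (u : twist Q) :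
    set_le [set s; t]%classic [set u]%classic <-> s <= u /\ t <= u.
  split=> [h|[hs ht] _ _ /= [->|->] -> //].
  by split; apply: h => //=; [left | right].
have set_ge2 (s t : twist Q) (u : twist Q) :
    set_le [set u]%classic [set s; t]%classic <-> u <= s /\ u <= t.
  split=> [h|[hs ht] _ _ /= -> [->|->] //].
  by split; apply: h => //=; [left | right].
case: p q r => [x y] [z v] [s t].
rewrite /twist_odot /twist_imp.
apply: (iff_trans (set_le2 _ _ _)); apply: iff_sym.
apply: (iff_trans (set_ge2 _ _ _)).
rewrite (twist_leE x y) (twist_leE (mul x z)) (twist_leE x y) !twist_leE.
rewrite !le_residual (mulC z t) (mulC t x).
by split=> [[/andP[-> ->] /andP[-> _]]|[/andP[-> ->] /andP[_ ->]]].
Qed.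

End ResiduatedMonoid.

(** * The set of pairs around [a] and its Kleene structure *)

Section TwistSubset.
Set Implicit Arguments.
Unset Strict Implicit.

Variables (d : Order.disp_t) (Q : tbPOrderType d) (a : Q).

Lemma Pa_mkP (x y : Q) :
  Pa a (mk_twist x y) <->
  (forall u, u <= x -> u <= y -> u <= a) /\
  (forall u, x <= u -> y <= u -> a <= u).
Proof.
split=> -[hL hU]; split.
- by move=> u ux uy; apply: (hL u a) => //; split=> //= _ [->|->].
- by move=> u xu yu; apply: (hU a u) => //; split=> //= _ [->|->].
- by move=> u _ [_ hu] ->; apply: hL; apply: hu; [left | right].
- by move=> _ u -> [_ hu]; apply: hU; apply: hu; [left | right].
Qed.

Lemma Pa_swap (x y : Q) : Pa a (mk_twist x y) -> Pa a (mk_twist y x).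
Proof. by move=> /Pa_mkP[hL hU]; apply/Pa_mkP; split=> u *; auto. Qed.

Lemma Pa_le (x y : Q) : x <= a -> a <= y -> Pa a (mk_twist x y).
Proof.
move=> xa ay; apply/Pa_mkP; split=> u.
- by move=> /le_trans-/(_ _ xa).
- by move=> _; apply: le_trans.
Qed.

Lemma Pa_ge (x y : Q) : a <= x -> y <= a -> Pa a (mk_twist x y).
Proof. by move=> ax ya; apply/Pa_swap/Pa_le. Qed.

Lemma Pa_diag (x : Q) : Pa a (mk_twist x a).
Proof. by apply/Pa_mkP; split. Qed.

Hypothesis Hcomp : forall p : twist Q, Pa a p -> p >=< mk_twist a a.

Lemma PaP (x y : Q) :
  Pa a (mk_twist x y) <-> (x <= a /\ a <= y) \/ (a <= x /\ y <= a).
Proof.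
split=> [/Hcomp|[[]|[]]]; [|exact: Pa_le|exact: Pa_ge].
by rewrite /Order.comparable !twist_leE => /orP[]/andP[]; auto.
Qed.

(** The pair [(a, a)] separates the cones: one of [p], [p'] lies below it and one of [q], [q'] above
    it. *)
Lemma Pa_pseudo_kleene : pseudo_kleene_poset (Pa a) (@twist_compl d Q).
Proof.
split.
- by move=> [x y] /= /Pa_swap.
- by move=> [x y] [z v] _ _; rewrite /= !twist_leE andbC.
- by case.
move=> p q Pp Pq l u [_ hl] [_ hu].
have {hl} hl : l <= mk_twist a a.
  case: p Pp hl => x y /PaP[[xa ay]|[ax ya]] hl.
  + by apply: (le_trans (hl _ (or_introl erefl))); rewrite twist_leE xa.
  + by apply: (le_trans (hl _ (or_intror erefl))); rewrite twist_leE ya.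
apply: (le_trans hl).
case: q Pq hu => x y /PaP[[xa ay]|[ax ya]] hu.
- by apply: le_trans (hu _ (or_intror erefl)); rewrite twist_leE ay.
- by apply: le_trans (hu _ (or_introl erefl)); rewrite twist_leE ax.
Qed.

(** * Closure under the operators and conditions (1) and (2) *)

Variables (mul imp : Q -> Q -> Q).
Hypothesis HQ : bounded_commutative_residuated_monoid mul imp.
Hypothesis Ha : mul a a = a.

Lemma Pa_odot_closed :
  (forall x, mul a x < a -> mul a x = \bot) ->
  (forall x, a < x -> imp x a = a) ->
  forall p q, Pa a p -> Pa a q -> (twist_odot mul imp p q `<=` Pa a)%classic.
Proof.
move=> h1 h2.
(* The second pair of the product is the first one with the factors exchanged. *)
suff closed1 (x y z v : Q) : Pa a (mk_twist x y) -> Pa a (mk_twist z v) ->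
    Pa a (mk_twist (mul x z) (imp x v)).
  move=> [x y] [z v] Pp Pq u /= [->|->]; first exact: closed1 Pp Pq.
  by rewrite (bcrm_mulC HQ); apply: closed1 Pq Pp.
have Pa_left w : Pa a (mk_twist a w) by apply/Pa_swap/Pa_diag.
have a_le_imp (s t : Q) : a <= t -> a <= imp s t.
  by rewrite (le_residual HQ); apply: le_trans; apply: mul_le_l HQ _ _.
move=> /PaP[[xa ay]|[ax ya]] /PaP[[za av]|[az va]].
- by apply: Pa_le (a_le_imp _ _ av); apply: le_trans (mul_le_l HQ _ _) xa.
(* Here [x <= a <= z]. If [a x < a], condition (1) gives [a x = 0], so [a <= x -> v]; otherwise
   [a = a x <= x z <= a], and a pair with first component [a] always belongs. *)
- have le_xz : mul x z <= a by apply: le_trans (mul_le_l HQ _ _) xa.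
  have [/h1 ax0|ax_ge] := boolP (mul a x < a).
    by apply: Pa_le le_xz _; rewrite (le_residual HQ) ax0 le0x.
  suff -> : mul x z = a by [].
  have axE : mul a x = a.
    by apply/eqP; move: ax_ge; rewrite lt_neqAle (mul_le_l HQ) andbT negbK.
  apply: le_anti; rewrite le_xz -{1}axE (bcrm_mulC HQ a x).
  exact: (le_mul2l HQ x az).
- apply: Pa_le (a_le_imp _ _ av); rewrite (bcrm_mulC HQ).
  exact: le_trans (mul_le_l HQ _ _) za.
(* Idempotency gives [a = a a <= x z]. If [a < x], condition (2) yields [x -> v <= x -> a = a]; if
   [x = a], the product collapses to [a]. *)
have le_xz : a <= mul x z by rewrite -Ha (le_mul HQ).
have [lt_ax|] := boolP (a < x).
  by apply: Pa_ge le_xz _; rewrite -[leRHS](h2 x lt_ax) (le_imp2l HQ).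
rewrite lt_neqAle ax andbT negbK => /eqP xE.
suff -> : mul x z = a by [].
by apply: le_anti; rewrite le_xz andbT -xE (mul_le_l HQ).
Qed.

Lemma Pa_imp_closed :
  (forall p q, Pa a p -> Pa a q -> (twist_odot mul imp p q `<=` Pa a)%classic) ->
  forall p q, Pa a p -> Pa a q -> (twist_imp mul imp p q `<=` Pa a)%classic.
Proof.
move=> closed [x y] [z v] Pp /Pa_swap Pq u /= [->|->]; apply: Pa_swap.
- exact: closed Pp Pq _ (or_introl erefl).
- exact: closed Pp Pq _ (or_intror erefl).
Qed.

Lemma odot_closed_mul_bot :
  (forall p q, Pa a p -> Pa a q -> (twist_odot mul imp p q `<=` Pa a)%classic) ->
  forall x, mul a x < a -> mul a x = \bot.
Proof.
move=> closed x lt_axa.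
have P10 : Pa a (mk_twist \top \bot) by apply: Pa_ge; rewrite ?lex1 ?le0x.
(* The pair tested is [(a x, a x -> 0)]; as [a x < a], membership forces [a <= a x -> 0], that is
   [a x = a a x <= 0]. *)
have := closed _ _ P10 (Pa_le (ltW lt_axa) (lex1 a)) _ (or_intror erefl).
rewrite (mul_top HQ) => /PaP[[_ ax_le]|[ax_ge _]].
- apply: le_anti; rewrite le0x andbT.
  by move: ax_le; rewrite (le_residual HQ) (bcrm_mulA HQ) Ha.
- by have := lt_le_trans lt_axa ax_ge; rewrite ltxx.
Qed.

Lemma odot_closed_imp :
  (forall p q, Pa a p -> Pa a q -> (twist_odot mul imp p q `<=` Pa a)%classic) ->
  forall x, a < x -> imp x a = a.
Proof.
move=> closed x lt_ax; apply: le_anti.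
rewrite [X in _ && X](le_residual HQ) (mul_le_l HQ) andbT.
have Px0 : Pa a (mk_twist x \bot) by apply: Pa_ge (ltW lt_ax) (le0x a).
(* The pair tested is [(x, x -> a)]; since [x <= a] fails, membership forces [x -> a <= a]. *)
have := closed _ _ Px0 (Pa_diag \top) _ (or_introl erefl).
move=> /PaP[[]|[_ //]]; rewrite (bcrm_mul1 HQ) => /(lt_le_trans lt_ax).
by rewrite ltxx.
Qed.

End TwistSubset.

Theorem theorem5p1 (d : Order.disp_t) (Q : tbPOrderType d)
    (mul imp : Q -> Q -> Q)
    (HQ : bounded_commutative_residuated_monoid mul imp)
    (a : Q) (Ha : mul a a = a)
    (Hcomp : forall p : twist Q, Pa a p -> p >=< mk_twist a a) :
  (operator_residuated_poset (Pa a) (twist_odot mul imp) (twist_imp mul imp)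
      (mk_twist (\bot : Q) \top) (mk_twist (\top : Q) \bot)
    <->
    (forall x : Q, (mul a x < a -> mul a x = \bot) /\
                   (a < x -> imp x a = a)))
  /\ pseudo_kleene_poset (Pa a) (@twist_compl d Q)
  /\ ((forall x : Q, Pa a (mk_twist x a)) /\
      {mono (fun x : Q => mk_twist x a) : x y / x <= y})
  /\ (forall p : twist Q, Pa a p ->
        twist_imp mul imp p (mk_twist (\bot : Q) \top) (twist_compl p)).
Proof.
split; [split | split; [exact: Pa_pseudo_kleene | split; [split |]]].
- move=> [_ _ _ _ closed _ _ _ _] x; split.
  + exact: (odot_closed_mul_bot Hcomp HQ Ha closed).
  + exact: (odot_closed_imp Hcomp HQ closed).
- move=> h.
  have closed : forall p q, Pa a p -> Pa a q ->
      (twist_odot mul imp p q `<=` Pa a)%classic.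
    by apply: (Pa_odot_closed Hcomp HQ Ha) => x; case: (h x).
  split.
  + by apply: Pa_le; rewrite ?lex1 ?le0x.
  + by apply: Pa_ge; rewrite ?lex1 ?le0x.
  + by move=> [x y] _; rewrite twist_leE le0x lex1.
  + by move=> [x y] _; rewrite twist_leE le0x lex1.
  + exact: closed.
  + exact: Pa_imp_closed.
  + by move=> p q _ _; apply: twist_odotC.
  + by move=> p q r _ _ _; apply: twist_odotA.
  + by move=> p q r _ _ _; apply: twist_residuation.
- exact: Pa_diag.
- by move=> x y; rewrite twist_leE lexx andbT.
(* The second pair is [(1 -> y, x 1)], which equals [(y, x)]. *)
- by move=> [x y] _ /=; right; rewrite (imp_top HQ) (bcrm_mul1 HQ).
Qed.
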